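(* For each choice of the sign $\pm$, the Diophantine equation $x^3\pm y^3=a^6-b^6$ has infinitely many nontrivial solutions $(x,y,a,b)$ in positive integers.
   Context: A quadruple $(x,y,a,b)$ of integers is called a nontrivial solution of an equation $x^3\pm y^3=a^k\pm b^k$ (signs fixed) if $\gcd(x,y,a,b)=1$ and no partial sum in the expression $x^3\pm y^3-(a^k\pm b^k)$ vanishes. *)

(* Defs.v *)
From HB Require Import structures.
From mathcomp Require Import all_boot all_order all_algebra.
Set Implicit Arguments.
Unset Strict Implicit.
Unset Printing Implicit Defensive.
Import Order.TTheory GRing.Theory Num.Theory.
Local Open Scope ring_scope.

(* A sign is encoded by a boolean, s standing for (-1) ^+ s: [false] is "+"
   and [true] is "-". *)

Definition solution (s t : bool) (k : nat) (x y a b : int) : Prop :=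
  x ^+ 3 + (-1) ^+ s * y ^+ 3 = a ^+ k + (-1) ^+ t * b ^+ k.

Definition terms (s t : bool) (k : nat) (x y a b : int) : 4.-tuple int :=
  [tuple x ^+ 3; (-1) ^+ s * y ^+ 3; - (a ^+ k); - ((-1) ^+ t * b ^+ k)].

(* Partial sums are those over nonempty proper subsets of the four terms: the
   full sum vanishes at every solution. *)
Definition no_vanishing_partial_sum (s t : bool) (k : nat) (x y a b : int) :
    Prop :=
  forall A : {set 'I_4}, (0 < #|A| < 4)%N ->
    \sum_(i in A) tnth (terms s t k x y a b) i <> 0.

Definition nontrivial_solution (s t : bool) (k : nat) (x y a b : int) : Prop :=
  [/\ solution s t k x y a b,
      gcdz (gcdz (gcdz x y) a) b = 1
    & no_vanishing_partial_sum s t k x y a b].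

(* Main.v *)
(** Ordering the terms of Mahler's identity
    (9n^4)^3 + (3nm^3 - 9n^4)^3 + (m^4 - 9mn^3)^3 = m^12 differently gives
    (3n(m^3 - 3n^3))^3 + (m(m^3 - 9n^3))^3 = (m^2)^6 - (3n^2)^6.
    The second base is positive for m^3 > 9n^3, and negative with the first one
    still positive for 3n^3 < m^3 < 9n^3; these ranges yield the two signs.
    When m is coprime to 3n, m^2 and 3n^2 are coprime, and as 3 divides the
    first and the last base but not m^2, no partial sum vanishes. *)
Require Import Defs.
From mathcomp Require Import all_boot all_order all_algebra.
From mathcomp Require Import boolp classical_sets cardinality.
From mathcomp Require Import ring zify.
Import Order.TTheory GRing.Theory Num.Theory.
Local Open Scope classical_set_scope.
Local Open Scope ring_scope.

(** Since the total is zero, complementary subsets have opposite sums, so it suffices to check the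
    single terms and the pairs containing [p]. *)
Lemma sum_subset4_neq0 (p q r v : int) (A : {set 'I_4}) :
  p + q + r + v = 0 ->
  [/\ p != 0, q != 0, r != 0 & v != 0] ->
  [/\ p + q != 0, p + r != 0 & p + v != 0] ->
  (0 < #|A| < 4)%N -> \sum_(i in A) tnth [tuple p; q; r; v] i <> 0.
Proof.
move=> sum0 [p0 q0 r0 v0] [pq pr pv].
rewrite -sum1_card big_mkcond [in X in _ -> X]big_mkcond /=.
rewrite !big_ord_recl !big_ord0 !(tnth_nth 0) /=.
do 4 case: (_ \in A); rewrite /=; lia.
Qed.

(** The cube of [y] equals that of its absolute value up to the sign of [y]; reading the equation's
    sign off [y < 0] treats both signs at once. *)
Lemma mahler_nontrivial_solution (m n x y : int) :
  0 < n -> coprimez m (3 * n) ->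
  x = 3 * n * (m ^+ 3 - 3 * n ^+ 3) -> y = m * (m ^+ 3 - 9 * n ^+ 3) ->
  0 < x -> y != 0 ->
  nontrivial_solution (y < 0) true 6 x `|y| (m ^+ 2) (3 * n ^+ 2).
Proof.
move=> n0 cop Ex Ey x0 y0.
have signy : (-1) ^+ (y < 0)%R * `|y| ^+ 3 = y ^+ 3.
  by have [h|h] := ltP y 0; rewrite ?(ltr0_norm h) ?(ger0_norm h) ?expr1; ring.
have sol : solution (y < 0) true 6 x `|y| (m ^+ 2) (3 * n ^+ 2).
  by rewrite /solution signy expr1 Ex Ey; ring.
have [cop3 copn] : coprimez m 3 /\ coprimez m n.
  by move: cop; rewrite coprimezMr => /andP[].
have copab : coprimez (m ^+ 2) (3 * n ^+ 2).
  by rewrite coprimezXl // coprimezMr cop3 coprimezXr.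
have na6 : ~~ (3 %| (m ^+ 2) ^+ 6)%Z.
  apply/negP => d; have : coprimez ((m ^+ 2) ^+ 6) 3 by rewrite !coprimezXl.
  by rewrite coprimez_sym /coprimez (gcdz_idPl _).
have x3 : (3 %| x ^+ 3)%Z by rewrite Ex -!mulrA exprMn dvdz_mulr.
have b6 : (3 %| (3 * n ^+ 2) ^+ 6)%Z by rewrite exprMn dvdz_mulr.
have m0 : m != 0 by apply: contraNneq y0 => m0; rewrite Ey m0 mul0r.
have b0 : 0 < (3 * n ^+ 2) ^+ 6 by rewrite exprn_gt0 // mulr_gt0 // exprn_gt0.
have x3pos : 0 < x ^+ 3 by rewrite exprn_gt0.
have a0 : (m ^+ 2) ^+ 6 != 0 by rewrite !expf_neq0.
have y3 : y ^+ 3 != 0 by rewrite expf_neq0.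
split=> //.
  by rewrite -gcdzA (eqP copab) gcdz1.
have xa : x ^+ 3 != (m ^+ 2) ^+ 6 by apply: contraNneq na6 => <-.
have ba : (3 * n ^+ 2) ^+ 6 != (m ^+ 2) ^+ 6 by apply: contraNneq na6 => <-.
move: sol => + A; rewrite /solution /terms signy expr1.
move: {x3 b6 na6} (x ^+ 3) (y ^+ 3) ((m ^+ 2) ^+ 6) ((3 * n ^+ 2) ^+ 6)
  x3pos y3 a0 b0 xa ba => X Y P Q X0 Y0 P0 Q0 XP QP sol.
clear -X0 Y0 P0 Q0 XP QP sol.
(* The pairs with [X] sum to [X + Y = P - Q], nonzero by [QP], to [X - P], nonzero by [XP], and to
   [X + Q], which is positive. *)
by apply: sum_subset4_neq0; [|split|split]; lia.
Qed.

Lemma infinite_set_injection (T : Type) (A : set T) (f : nat -> T) :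
  injective f -> (forall k, A (f k)) -> infinite_set A.
Proof.
move=> finj fA finA; apply: infinite_nat.
have -> : [set: nat] = f @^-1` A.
  by apply/seteqP; split=> // k _; exact: fA.
by apply: finite_preimage finA => i j _ _; exact: finj.
Qed.

(** Distinct indices give distinct quadruples because squaring is injective on the positive values
    of [m]. *)
Lemma mahler_infinite (s : bool) (m n : nat -> int) :
  injective m -> (forall k, 0 < m k) -> (forall k, 0 < n k) ->
  (forall k, coprimez (m k) (3 * n k)) ->
  (forall k, 3 * n k ^+ 3 < m k ^+ 3) ->
  (forall k, if s then m k ^+ 3 < 9 * n k ^+ 3 else 9 * n k ^+ 3 < m k ^+ 3) ->
  infinite_set [set q : int * int * int * int |
    let: (x, y, a, b) := q in
    [/\ 0 < x, 0 < y, 0 < a & 0 < b] /\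
    nontrivial_solution s true 6 x y a b].
Proof.
move=> minj m0 n0 cop lo hi.
pose x k := 3 * n k * (m k ^+ 3 - 3 * n k ^+ 3).
pose y k := m k * (m k ^+ 3 - 9 * n k ^+ 3).
have x0 k : 0 < x k by rewrite !mulr_gt0 // subr_gt0.
have ys k : (y k < 0) = s.
  rewrite pmulr_rlt0 // subr_lt0; have := hi k.
  by case: s {hi} => [-> //|/ltW]; rewrite leNgt => /negbTE.
have y0 k : y k != 0.
  apply: mulf_neq0; first by rewrite gt_eqF.
  rewrite subr_eq0.
  by have := hi k; case: s {hi ys} => h; rewrite ?(lt_eqF h) ?(gt_eqF h).
apply: (@infinite_set_injection _ _
  (fun k => (x k, `|y k|, m k ^+ 2, 3 * n k ^+ 2))) => [i j [_ _ mij _]|k].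
  by apply: minj; apply/eqP; rewrite -(@eqrXn2 _ 2) ?ltW //; apply/eqP.
split.
  split; [exact: x0|by rewrite normr_gt0|exact: exprn_gt0|].
  by rewrite mulr_gt0 ?exprn_gt0.
rewrite -[X in nontrivial_solution X](ys k).
exact: mahler_nontrivial_solution.
Qed.

Theorem mainTheorem4 (s : bool) :
  infinite_set [set q : int * int * int * int |
    let: (x, y, a, b) := q in
    [/\ 0 < x, 0 < y, 0 < a & 0 < b] /\
    nontrivial_solution s true 6 x y a b].
Proof.
case: s.
(* With [t = k + 5], the ratio [(6t + 1) / (3t)] is slightly above 2, while the cube root of 9 is
   about 2.08; the upper bound holds from [t = 5] on and fails at [t = 4]. *)
- apply: (@mahler_infinite true (fun k => 6 * (k + 5)%:Z + 1)
    (fun k => 3 * (k + 5)%:Z)) => [i j|k|k|k|k|k].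
  1-3: lia.
  + apply/coprimezP.
    by exists (1 - 6 * (k + 5)%:Z, 4 * (k + 5)%:Z) => /=; ring.
  + nia.
  + nia.
(* For [n = 1], [m] must be prime to 3 with cube above 9; in the class of 1 modulo 3 the first such
   value is 4. *)
- apply: (@mahler_infinite false (fun k => 3 * k%:Z + 4) (fun=> 1))
    => [i j|k|k|k|k|k].
  1-3: lia.
  + apply/coprimezP.
    by exists (1, - (k%:Z + 1)) => /=; ring.
  + nia.
  + nia.
Qed.
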